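(* Let $n\ge5$ and $K>0$. For any integer $q$ such that $1\le|q|<\frac n4$, the set of relevant saddles between the $q$-twisted state $u^{(q)}$ and the set $\{u^{(-|q|+1)},u^{(-|q|+2)},\dots,u^{(|q|-1)}\}$ is $$\bigl\{C_ju^{(|q|-1/2)},\ C_ju^{(-|q|+1/2)}\ :\ 0\le j\le n-1\bigr\}.$$
   Context: Indices are in $\Lambda=\mathbb{Z}/n\mathbb{Z}$ with representatives $0,\dots,n-1$, and $U(u)=-\frac{K}{2\pi}\sum_{i\in\Lambda}\cos(2\pi(u_{i+1}-u_i))$. Points of $\mathbb{R}^\Lambda$ are identified modulo integer translations $T_k u=u+k$ ($k\in\mathbb{Z}^\Lambda$) and global phase shifts $S_\varphi u=u+\varphi(1,\dots,1)$ ($\varphi\in\mathbb{R}$); $U$ is invariant under both, and the phase space is the resulting quotient. For an integer $k$, $u^{(k)}$ has components $u^{(k)}_i=\frac{ki}{n}$ ($i=0,\dots,n-1$). For a half-integer $r$, $u^{(r)}$ has components $u^{(r)}_i=\frac{ri}{n-2}$ ($i=0,\dots,n-1$). $C_j$ is the cyclic permutation $C_j(u_0,\dots,u_{n-1})=(u_j,\dots,u_{n-1+j})$ (indices mod $n$). Given sets $A,B$ in phase space, the communication height is $\overline U(A,B)=\inf_{\gamma}\sup_{t\in[0,1]}U(\gamma(t))$, the infimum being over continuous paths $\gamma:[0,1]\to$ phase space with $\gamma(0)\in A$, $\gamma(1)\in B$. A minimal path from $A$ to $B$ is such a path with $\sup_tU(\gamma(t))=\overline U(A,B)$. Points $w_1,\dots,w_m$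 of a finite set are called relevant saddles between $A$ and $B$ if $U(w_1)=\dots=U(w_m)=\overline U(A,B)$ and any minimal path from $A$ to $B$ contains at least one of these points. *)

(* Defs.v *)
From HB Require Import structures.
From mathcomp Require Import all_boot all_order all_algebra generic_quotient.
From mathcomp Require Import all_classical all_reals all_analysis.
Set Implicit Arguments.
Unset Strict Implicit.
Unset Printing Implicit Defensive.
Import Order.TTheory GRing.Theory Num.Theory.
Import numFieldNormedType.Exports.
Local Open Scope classical_set_scope.
Local Open Scope ring_scope.
Local Open Scope quotient_scope.

(* Configurations are row vectors indexed by 'I_n; the cyclic structure of
   the index set Z/nZ is carried by [ordS], i.e. i |-> i + 1 mod n. *)

Definition potential (R : realType) (n : nat) (K : R) (u : 'rV[R]_n) : R :=
  - (K / (2 * pi)) * \sum_(i < n) cos (2 * pi * (u 0 (ordS i) - u 0 i)).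

Definition translation (R : realType) (n : nat) (k : 'rV[int]_n)
  (u : 'rV[R]_n) : 'rV[R]_n := u + \row_(i < n) (k 0 i)%:~R.

Definition phase_shift (R : realType) (n : nat) (phi : R)
  (u : 'rV[R]_n) : 'rV[R]_n := u + const_mx phi.

(* The translations and the phase shifts commute, so this is the orbit
   relation of the group they generate. *)
Definition same_phase (R : realType) (n : nat) : rel 'rV[R]_n :=
  fun u v => `[< exists (k : 'rV[int]_n) (phi : R),
                   v = phase_shift phi (translation k u) >].

Lemma same_phase_refl (R : realType) (n : nat) : reflexive (@same_phase R n).
Proof.
move=> u; apply/asboolP; exists 0, 0.
by apply/rowP => i; rewrite !mxE mulr0z !addr0.
Qed.

Lemma same_phase_sym (R : realType) (n : nat) : symmetric (@same_phase R n).
Proof.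
suff S (u v : 'rV[R]_n) : same_phase u v -> same_phase v u.
  by move=> u v; apply/idP/idP; exact: S.
move=> /asboolP[k [phi ->]]; apply/asboolP; exists (- k), (- phi).
by apply/rowP => i; rewrite !mxE intrN addrAC addrK addrK.
Qed.

Lemma same_phase_trans (R : realType) (n : nat) : transitive (@same_phase R n).
Proof.
move=> v u w /asboolP[k [phi ->]] /asboolP[l [psi ->]].
apply/asboolP; exists (k + l), (phi + psi).
by apply/rowP => i; rewrite !mxE intrD !addrA; congr (_ + _); rewrite addrAC.
Qed.

Canonical same_phase_equiv (R : realType) (n : nat) :=
  EquivRel (@same_phase R n) (@same_phase_refl R n) (@same_phase_sym R n)
    (@same_phase_trans R n).

Notation phase_space R n :=
  (quotient_topology {eq_quot (same_phase_equiv R n)}).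

Definition phase_class (R : realType) (n : nat) (u : 'rV[R]_n) :
  phase_space R n := \pi_(phase_space R n) u.

Lemma phase_classP (R : realType) (n : nat) (u v : 'rV[R]_n) :
  phase_class u = phase_class v <->
  exists (k : 'rV[int]_n) (phi : R), v = phase_shift phi (translation k u).
Proof.
have -> : (phase_class u = phase_class v) =
  (u = v %[mod {eq_quot (same_phase_equiv R n)}]) by [].
by split => [/eqmodP/asboolP|h]; [|apply/eqmodP/asboolP].
Qed.

Definition phase_potential (R : realType) (n : nat) (K : R)
  (x : phase_space R n) : R := potential K (repr x).

Lemma cos_periodz (R : realType) (x : R) (m : int) :
  cos (x + 2 * pi * m%:~R) = cos x.
Proof.
have P (y : R) (j : nat) : cos (y + 2 * pi * j%:R) = cos y.
  by rewrite mulr_natr mulr_natl; exact: (periodicn (@cosD2pi R)).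
case: m => j; first exact: P.
by rewrite NegzE intrN mulrN -[in RHS](subrK (2 * pi * j.+1%:R) x) P.
Qed.

Lemma potential_translation (R : realType) (n : nat) (K : R) (k : 'rV[int]_n)
  (u : 'rV[R]_n) : potential K (translation k u) = potential K u.
Proof.
congr (_ * _); apply: eq_bigr => i _; rewrite !mxE.
rewrite -[RHS](cos_periodz _ (k 0 (ordS i) - k 0 i)) -mulrDr intrB.
by congr (cos (_ * _)); rewrite opprD addrACA.
Qed.

Lemma potential_phase_shift (R : realType) (n : nat) (K phi : R)
  (u : 'rV[R]_n) : potential K (phase_shift phi u) = potential K u.
Proof.
congr (_ * _); apply: eq_bigr => i _; rewrite !mxE.
by rewrite opprD addrACA subrr addr0.
Qed.

Lemma phase_potentialE (R : realType) (n : nat) (K : R) (u : 'rV[R]_n) :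
  phase_potential K (phase_class u) = potential K u.
Proof.
have /phase_classP[k [phi uE]] :
  phase_class (repr (phase_class u)) = phase_class u by exact: reprK.
by rewrite [in RHS]uE potential_phase_shift potential_translation.
Qed.

Definition paths (R : realType) (n : nat) (A B : set (phase_space R n)) :
    set (R -> phase_space R n) :=
  [set g : R -> phase_space R n |
    [/\ {within `[0, 1]%classic : set R, continuous g}, A (g 0) & B (g 1)]].

Definition path_height (R : realType) (n : nat) (K : R)
    (g : R -> phase_space R n) : \bar R :=
  ereal_sup [set (phase_potential K (g t))%:E | t in `[0, 1]%classic].

(* Heights live in \bar R, so the infimum over an empty set of paths is +oo. *)
Definition communication_height (R : realType) (n : nat) (K : R)
    (A B : set (phase_space R n)) : \bar R :=
  ereal_inf [set path_height K g | g in paths A B].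

Definition minimal_path (R : realType) (n : nat) (K : R)
    (A B : set (phase_space R n)) (g : R -> phase_space R n) : Prop :=
  paths A B g /\ path_height K g = communication_height K A B.

(* A property of the finite set W; W is not required to be minimal. *)
Definition relevant_saddles (R : realType) (n : nat) (K : R)
    (A B W : set (phase_space R n)) : Prop :=
  [/\ finite_set W,
      (forall w, W w ->
         (phase_potential K w)%:E = communication_height K A B) &
      (forall g, minimal_path K A B g ->
         exists2 t : R, 0 <= t <= 1 & W (g t))].

Definition twisted_state (R : realType) (n : nat) (k : int) : 'rV[R]_n :=
  \row_(i < n) (k%:~R * i%:R / n%:R).

(* Used only for half-integer r. *)
Definition half_twisted_state (R : realType) (n : nat) (r : R) : 'rV[R]_n :=
  \row_(i < n) (r * i%:R / (n%:R - 2)).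

Definition cyclic_perm (R : realType) (n j : nat) (u : 'rV[R]_n) : 'rV[R]_n :=
  \row_(i < n) u 0 (iter j (@ordS n) i).

(* Main.v *)
(* Write y_i for s (u_(i+1) - u_i) modulo integers, with s the sign of q, Q = |q|
   and a = (Q - 1/2)/(n - 2) < 1/4. Instead of lifting paths, split the phase space
   by the level c = 1/2 - a: the classes having representatives y_i of sum Q with
   all y_i < c form an open set containing u^(q); those having representatives of
   sum less than Q with all y_i > c - 1 form a disjoint open set containing the
   targets. A path joining the two has, by connectedness, a point with
   representatives of sum Q, maximum exactly c. There the tangent of cos(2 pi y)
   at a lies above the graph for all y <= 1/2 - a, touching it only at y = a, so
   the energy is at least that of the saddles, with equality only when all the other
   y_i equal a, i.e. at a saddle. The path b |-> (b i)_i with b from q/n to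
   (q - s)/n never exceeds the energy of the saddles, by the tangent inequality
   taken at |b|. *)
Require Import Defs.
From mathcomp Require Import all_boot all_order all_algebra generic_quotient.
From mathcomp Require Import all_classical all_reals all_analysis.
From mathcomp Require Import ring lra zify.
Import Order.TTheory GRing.Theory Num.Theory.
Import numFieldNormedType.Exports.
Local Open Scope classical_set_scope.
Local Open Scope ring_scope.
Set Implicit Arguments.
Unset Strict Implicit.
Unset Printing Implicit Defensive.

(** * Tangent lines to the cosine *)

Lemma sin_secant (R : realType) (x : R) : 0 < x ->
  exists2 c, 0 < c < x & sin x = cos c * x.
Proof.
move=> x0.
have cs : {within `[0, x], continuous (@sin R)}.
  by apply: continuous_subspaceT => y; exact: continuous_sin.
have [c] := MVT x0 (fun y _ => is_derive_sin y) cs.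
by rewrite in_itv/= sin0 !subr0 => cx ->; exists c.
Qed.

Lemma sin_ltr (R : realType) (x : R) : 0 < x -> sin x < x.
Proof.
move=> x0; have [x1|x1] := ltP 1 x; first exact: le_lt_trans (sin_le1 x) x1.
have [c /andP[c0 cx] ->] := sin_secant x0.
have p2 := pi_ge2 R.
by rewrite gtr_pMl// -(cos0 R) ltr_cos ?in_itv//=; lra.
Qed.

Lemma xcos_lt_sin (R : realType) (x : R) : 0 < x <= pi -> x * cos x < sin x.
Proof.
move=> /andP[x0 xpi]; have [c /andP[c0 cx] ->] := sin_secant x0.
by rewrite mulrC ltr_pM2r// ltr_cos ?in_itv//=; lra.
Qed.

(** With z = b + s the gap is cos b (1 - cos s) - sin b (s - sin s). For s < 0 the second product is
    negative. For s > 0 the bound s/2 <= pi/2 - b gives sin b <= cos (s/2) and sin (s/2) <= cos b,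
    which reduces the claim to the extreme case z = pi - b. *)
Lemma cos_lt_tangent (R : realType) (b z : R) : 0 < b < pi / 2 -> z <= pi - b ->
  z != b -> cos z < cos b - sin b * (z - b).
Proof.
move=> /andP[b0 bpi] zb zNb.
have sb : 0 < sin b by apply: sin_gt0_pihalf; rewrite b0.
have cb : 0 < cos b by apply: cos_gt0_pihalf; rewrite bpi; lra.
set s := z - b; have -> : z = b + s by rewrite /s; ring.
rewrite cosD -subr_gt0.
have -> : cos b - sin b * s - (cos b * cos s - sin b * sin s) =
  cos b * (1 - cos s) - sin b * (s - sin s) by ring.
rewrite subr_gt0; have [s0|s0|/eqP] := ltgtP s 0; last first.
- by rewrite /s subr_eq0 (negPf zNb).
- (* In terms of x = s/2 the claim reduces to x cos x < sin x. *)
  have [x [sx x0]] : exists x, s = x + x /\ 0 < x by exists (s / 2); lra.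
  have xb : x <= pi / 2 - b by move: sx; rewrite /s; lra.
  have cx : 0 < cos x by apply: cos_gt0_pihalf; lra.
  have sinx : 0 < sin x by apply: sin_gt0_pihalf; lra.
  have xlt : x * cos x < sin x by apply: xcos_lt_sin; lra.
  have le1 : sin b <= cos x.
    rewrite -cosBpihalf -cosN opprB leNgt ltr_cos ?in_itv/=; lra.
  have le2 : sin x <= cos b.
    rewrite -cosBpihalf -cosN opprB leNgt ltr_cos ?in_itv/=; lra.
  rewrite sx sinD cosD.
  have cs : cos x ^+ 2 + sin x ^+ 2 = 1 by exact: cos2Dsin2.
  have sl := sin_ltr x0.
  have -> : 1 - (cos x * cos x - sin x * sin x) = 2 * sin x ^+ 2.
    by nra.
  apply: (@le_lt_trans _ _ (cos x * (x + x - (sin x * cos x + cos x * sin x)))).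
    apply: ler_wpM2r => //; have := cos_le1 x; nra.
  apply: (@lt_le_trans _ _ (sin x * (2 * sin x ^+ 2))); last first.
    by apply: ler_wpM2r => //; apply: mulr_ge0 => //; exact: sqr_ge0.
  have -> : sin x * (2 * sin x ^+ 2) = 2 * sin x * (1 - cos x ^+ 2).
    by nra.
  nra.
- have := @sin_ltr R (- s); rewrite sinN oppr_gt0 => /(_ s0) ss.
  apply: (@lt_le_trans _ _ 0); first nra.
  by apply: mulr_ge0; [exact: ltW|rewrite subr_ge0; exact: cos_le1].
Qed.

Lemma cos2pi_tangent (R : realType) (b y : R) : 0 < b < 1 / 4 ->
  y <= 1 / 2 - b ->
  cos (2 * pi * y) <= cos (2 * pi * b) - 2 * pi * sin (2 * pi * b) * (y - b)
    ?= iff (y == b).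
Proof.
move=> /andP[b0 b4] yb; have p0 := pi_gt0 R.
have [->|yNb] := eqVneq y b; first by rewrite subrr mulr0 subr0; exact/leif_refl.
suff lt : cos (2 * pi * y) < cos (2 * pi * b) - 2 * pi * sin (2 * pi * b) * (y - b).
  by split; [exact: ltW|rewrite (lt_eqF lt)].
have -> : 2 * pi * sin (2 * pi * b) * (y - b) =
  sin (2 * pi * b) * (2 * pi * y - 2 * pi * b) by ring.
apply: cos_lt_tangent; first by apply/andP; split; nra.
- nra.
- by rewrite (inj_eq (mulfI _))// gt_eqF// mulr_gt0.
Qed.

(** The value b = 0 is included because for |q| = 1 the connecting path ends at slope 0; the tangent
    there is the constant 1. *)
Lemma cos2pi_le_tangent (R : realType) (b y : R) : 0 <= b < 1 / 4 ->
  y <= 1 / 2 - b ->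
  cos (2 * pi * y) <= cos (2 * pi * b) - 2 * pi * sin (2 * pi * b) * (y - b).
Proof.
move=> /andP[b0 b4] yb; have [b00|bN0] := eqVneq b 0.
  by rewrite b00 mulr0 cos0 sin0 mulr0 mul0r subr0 cos_le1.
by apply: cos2pi_tangent => //; rewrite lt_def bN0 b0 b4.
Qed.

Lemma cos2pi_half (R : realType) (b : R) :
  cos (2 * pi * (1 / 2 - b)) = - cos (2 * pi * b).
Proof.
have -> : 2 * pi * (1 / 2 - b) = - (2 * pi * b) + pi by field.
by rewrite cosDpi cosN.
Qed.

(** The term at [i0] is -cos(2 pi b), and the other n - 1 values have mean b, so the linear parts of
    their tangents at b cancel in the sum. *)
Lemma sum_cos_leif (R : realType) (n : nat) (b : R) (y : 'I_n -> R) (i0 : 'I_n) :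
  0 < b < 1 / 4 -> y i0 = 1 / 2 - b -> (forall i, y i <= 1 / 2 - b) ->
  \sum_i y i = (n%:R - 2) * b + 1 / 2 ->
  \sum_i cos (2 * pi * y i) <= (n%:R - 2) * cos (2 * pi * b)
    ?= iff [forall (i | i != i0), y i == b].
Proof.
move=> b4 yi0 yb.
have cst (x : R) : \sum_(i < n | i != i0) x = (n%:R - 1) * x.
  rewrite sumr_const cardC1 card_ord mulrBl mul1r mulr_natl.
  by rewrite -[in RHS](prednK (leq_ltn_trans (leq0n i0) (ltn_ord i0))) mulrSr addrK.
rewrite (bigD1 i0)//= (bigD1 i0 (P := predT))//= yi0 cos2pi_half => sy.
have /= tg := leif_sum (fun (i : 'I_n) (_ : i != i0) =>
  cos2pi_tangent b4 (yb i)).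
have sb : \sum_(i < n | i != i0)
    (cos (2 * pi * b) - 2 * pi * sin (2 * pi * b) * (y i - b)) =
    (n%:R - 1) * cos (2 * pi * b).
  rewrite sumrB -mulr_sumr sumrB !cst.
  have -> : \sum_(i < n | i != i0) y i = (n%:R - 1) * b by lra.
  by rewrite subrr mulr0 subr0.
rewrite sb in tg.
have rf : - cos (2 * pi * b) <= - cos (2 * pi * b) ?= iff true by exact/leif_refl.
have := leifD rf tg.
have -> : - cos (2 * pi * b) + (n%:R - 1) * cos (2 * pi * b) =
  (n%:R - 2) * cos (2 * pi * b) by ring.
by rewrite andTb.
Qed.

(** * Differences along the cycle and the open regions they define *)

Definition edge (R : realType) (n : nat) (u : 'rV[R]_n) (i : 'I_n) : R :=
  u 0 (ordS i) - u 0 i.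

Lemma sum_ordS (V : zmodType) (n : nat) (f : 'I_n -> V) :
  \sum_i (f (ordS i) - f i) = 0.
Proof.
rewrite sumrB [X in X - _](_ : _ = \sum_i f i) ?subrr//.
by rewrite [RHS](reindex_inj (bij_inj (@ordS_bij n))).
Qed.

Lemma ordS_induction (n : nat) (P : 'I_n.+1 -> Prop) :
  P ord0 -> (forall i, P i -> P (ordS i)) -> forall i, P i.
Proof.
move=> P0 PS [i]; elim: i => [|i IH] lti.
  by rewrite (_ : Ordinal lti = ord0)//; exact: val_inj.
have lti' := ltnW lti; rewrite (_ : Ordinal lti = ordS (Ordinal lti')).
  exact/PS/IH.
by apply: val_inj; rewrite /= modn_small.
Qed.

Lemma edge_phase_class (R : realType) (n : nat) (u v : 'rV[R]_n) :
  phase_class u = phase_class v ->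
  exists2 m : 'I_n -> int, \sum_i m i = 0 &
    forall i, edge v i = edge u i + (m i)%:~R.
Proof.
move=> /phase_classP[k [phi ->]].
exists (fun i => k 0 (ordS i) - k 0 i); first exact: (sum_ordS (k 0)).
by move=> i; rewrite /edge !mxE intrB; ring.
Qed.

(** Partial sums of m, starting from index 0, give the integer translation; the phase shift is the
    discrepancy at index 0. *)
Lemma phase_class_edge (R : realType) (n : nat) (u v : 'rV[R]_n.+1)
    (m : 'I_n.+1 -> int) :
  (forall i, edge v i = edge u i + (m i)%:~R) ->
  phase_class u = phase_class v.
Proof.
move=> uv; apply/phase_classP.
have /choice[k kE] (i : 'I_n.+1) :
    exists k : int, v 0 i - u 0 i = v 0 ord0 - u 0 ord0 + k%:~R.
  move: i; apply: ordS_induction => [|i [k ki]]; first by exists 0; rewrite addr0.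
  exists (k + m i); have := uv i; rewrite /edge intrD => e; lra.
exists (\row_i k i), (v 0 ord0 - u 0 ord0).
by apply/rowP => i; rewrite !mxE; have := kE i => e; lra.
Qed.

(* With P = [set Q] this is the set of classes having differences of sum Q below c;
   [region (- s) (- c) [set S | - Q - n < S]] encodes, through m |-> - m - 1, those
   having differences of sum less than Q above c - 1. *)
Definition region (R : realType) (n : nat) (s : int) (c : R) (P : set int) :
    set (phase_space R n) :=
  [set x | exists2 m : 'I_n -> int, P (\sum_i m i) &
    forall i, s%:~R * edge (repr x) i + (m i)%:~R < c].

(** Another representative changes the differences by integers l of sum zero; replacing m by m - s l
    absorbs them without changing the sum of m. *)
Lemma region_phase_class (R : realType) (n : nat) (s : int) (c : R)
    (P : set int) (u : 'rV[R]_n) :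
  region s c P (phase_class u) <->
  exists2 m : 'I_n -> int, P (\sum_i m i) &
    forall i, s%:~R * edge u i + (m i)%:~R < c.
Proof.
have tr (v w : 'rV[R]_n) : phase_class v = phase_class w ->
   (exists2 m : 'I_n -> int, P (\sum_i m i) &
     forall i, s%:~R * edge v i + (m i)%:~R < c) ->
   exists2 m : 'I_n -> int, P (\sum_i m i) &
     forall i, s%:~R * edge w i + (m i)%:~R < c.
  move=> /edge_phase_class[l l0 lE] [m Pm mc].
  exists (fun i => m i - s * l i); first by rewrite sumrB -mulr_sumr l0 mulr0 subr0.
  by move=> i; move: (mc i); rewrite lE intrB intrM; congr (_ < _); ring.
have ru : phase_class (repr (phase_class u)) = phase_class u.
  exact: reprK.
by split; apply: tr.
Qed.

Lemma edge_continuous (R : realType) (n : nat) (i : 'I_n) :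
  continuous (fun u : 'rV[R]_n => edge u i).
Proof.
move=> u.
exact: (cvgB (@coord_continuous R 1 n 0 (ordS i) u) (@coord_continuous R 1 n 0 i u)).
Qed.

Lemma open_region (R : realType) (n : nat) (s : int) (c : R) (P : set int) :
  open (region s c P : set (phase_space R n)).
Proof.
suff : open [set u : 'rV[R]_n | region s c P (phase_class u)] by [].
(* Openness in the quotient is openness of the preimage, which is a union over m of finite
   intersections of open half-spaces. *)
rewrite (_ : [set u | _] = \bigcup_(m in [set m : 'I_n -> int | P (\sum_i m i)])
    [set u : 'rV[R]_n | forall i, s%:~R * edge u i + (m i)%:~R < c]).
  apply: bigcup_open => m _; rewrite openE => u mc.
  apply: (@filter_forall _ 'I_n
    (fun i => [set v : 'rV[R]_n | s%:~R * edge v i + (m i)%:~R < c])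
    _ (nbhs_filter u)) => i.
  have cf : continuous_at u (fun v : 'rV[R]_n => s%:~R * edge v i + (m i)%:~R).
    exact: cvgD (cvgM (cvg_cst _) (@edge_continuous R n i u)) (cvg_cst _).
  exact: (cvgr_lt _ cf _ (mc i)).
apply/seteqP; split => u.
  by move=> /region_phase_class[m Pm mc]; exists m.
by move=> [m Pm mc]; apply/region_phase_class; exists m.
Qed.

(** * Crossing points of a path and their representatives *)

Lemma connected_crossing (R : realType) (T : topologicalType) (V N : set T) (g : R -> T) :
  open V -> open N -> V `&` N = set0 -> {within `[0, 1], continuous g} ->
  V (g 0) -> N (g 1) -> exists2 t, 0 <= t <= 1 & ~ V (g t) /\ ~ N (g t).
Proof.
move=> oV oN VN cg V0 N1; apply: contrapT => nt.
have cov t : 0 <= t <= 1 -> V (g t) \/ N (g t).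
  move=> t01; apply: contrapT => /not_orP VNt; apply: nt; exists t => //.
have cI : connected (g @` `[0, 1]).
  by apply: connected_continuous_connected cg; exact: segment_connected.
have I0 : (g @` `[0, 1]) (g 0) by exists 0 => //=; rewrite in_itv/= lexx ler01.
have I1 : (g @` `[0, 1]) (g 1) by exists 1 => //=; rewrite in_itv/= lexx ler01.
(* If V and N covered the image, its trace on V would be open, and also closed as the trace on the
   complement of N, hence the whole image. *)
have e : g @` `[0, 1] `&` V = g @` `[0, 1].
  apply: cI.
  - by exists (g 0).
  - by exists V.
  - exists (~` N); first exact: open_closedC.
    apply/seteqP; split => x [[t t01 tx] Wx]; (split; first by exists t).
      by move=> Nx; have : (V `&` N) x by []; rewrite VN.
    by rewrite -tx in Wx *; case: (cov t) => //; move: t01; rewrite /= in_itv.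
have : (V `&` N) (g 1) by split => //; move: I1; rewrite -e => -[].
by rewrite VN.
Qed.

Lemma cos2pi_sign (R : realType) (s : int) (x : R) : s * s = 1 ->
  cos (2 * pi * (s%:~R * x)) = cos (2 * pi * x).
Proof.
move=> s1; have /orP[/eqP->|/eqP->] : (s == 1) || (s == - 1).
  by rewrite -sqrf_eq1 expr2 s1.
- by rewrite mul1r.
- by rewrite intrN mulN1r mulrN cosN.
Qed.

Lemma cos2piDz (R : realType) (x : R) (m : int) :
  cos (2 * pi * (x + m%:~R)) = cos (2 * pi * x).
Proof. by rewrite mulrDr cos_periodz. Qed.

Lemma potential_edge (R : realType) (n : nat) (K : R) (s : int) (m : 'I_n -> int)
    (u : 'rV[R]_n) : s * s = 1 ->
  potential K u =
    - (K / (2 * pi)) * \sum_i cos (2 * pi * (s%:~R * edge u i + (m i)%:~R)).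
Proof.
move=> s1; congr (_ * _); apply: eq_bigr => i _.
by rewrite cos2piDz cos2pi_sign.
Qed.

Lemma sum_edge (R : realType) (n : nat) (u : 'rV[R]_n) : \sum_i edge u i = 0.
Proof. exact: (sum_ordS (u 0)). Qed.

(** Adding the two strict inequalities gives m_i + l_i < 0, so m_i <= - l_i - 1 by integrality;
    summing over i contradicts the condition on the sum of l. *)
Lemma region_disjoint (R : realType) (n : nat) (s Q : int) (c : R) :
  region s c [set Q] `&`
  region (- s) (- c) [set S : int | - Q - n%:Z < S] = set0 :> set (phase_space R n).
Proof.
apply/seteqP; split => // x [[m /= mQ mc] [l /= lQ lc]].
have ml (i : 'I_n) : m i <= - l i - 1.
  suff : m i + l i < 0 by lia.
  by rewrite -(ltrz0 R) intrD; move: (mc i) (lc i); rewrite intrN; lra.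
have : \sum_i m i <= \sum_i (- l i - 1) by exact: ler_sum.
rewrite mQ sumrB sumrN sumr_const card_ord natz; lra.
Qed.

Lemma between_regions (R : realType) (n : nat) (s Q : int) (c : R) (u : 'rV[R]_n.+1) :
  ~ region s c [set Q] (phase_class u) ->
  ~ region (- s) (- c) [set S : int | - Q - n.+1%:Z < S] (phase_class u) ->
  exists m : 'I_n.+1 -> int, [/\ \sum_i m i = Q,
    forall i, s%:~R * edge u i + (m i)%:~R <= c &
    exists i0, s%:~R * edge u i0 + (m i0)%:~R = c].
Proof.
move=> /region_phase_class nin /region_phase_class nout.
suff [m mQ mc] : exists2 m : 'I_n.+1 -> int, \sum_i m i = Q &
    forall i, s%:~R * edge u i + (m i)%:~R <= c.
  exists m; split => //; apply: contrapT => nex; apply: nin; exists m => // i.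
  by rewrite lt_neqAle mc andbT; apply/eqP => e; apply: nex; exists i.
(* [f i] is the largest integer keeping the representative at most c. If these sum to less than Q,
   then - f - 1 witnesses the second region. *)
pose f i := Num.floor (c - s%:~R * edge u i).
have fle i : s%:~R * edge u i + (f i)%:~R <= c.
  by have := floor_le (c - s%:~R * edge u i); rewrite -/(f i); lra.
have flt i : c < s%:~R * edge u i + (f i)%:~R + 1.
  by have := floorD1_gt (c - s%:~R * edge u i); rewrite -/(f i) intrD; lra.
have [Qf|fQ] := leP Q (\sum_i f i); last first.
  exfalso; apply: nout; exists (fun i => - f i - 1).
    by rewrite /= sumrB sumrN sumr_const card_ord natz; lra.
  by move=> i; rewrite intrB !intrN; have := flt i; lra.
(* The excess of the sum over Q is removed at a single index, which only lowers a representative. *)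
exists (fun i => f i - (i == ord0)%:R * (\sum_i f i - Q)) => [|i].
  have s1 : \sum_(i < n.+1) ((i == ord0)%:R : int) = 1.
    by rewrite (bigD1 ord0)//= big1 ?addr0// => i /negPf->.
  by rewrite sumrB -mulr_suml s1 mul1r subKr.
rewrite intrB; apply: le_trans (fle i); rewrite lerD2l gerBl ler0z.
by apply: mulr_ge0; rewrite ?ler0n ?subr_ge0.
Qed.

(** * Ramps: their energies and the classes of the saddles *)

(** One family containing the twisted states, the half-integer states and the connecting path. *)
Definition ramp (R : realType) (n : nat) (b : R) : 'rV[R]_n :=
  \row_(i < n) (b * i%:R).

Lemma twisted_ramp (R : realType) (n : nat) (k : int) :
  twisted_state R n k = ramp n (k%:~R / n%:R).
Proof. by apply/rowP => i; rewrite !mxE mulrAC. Qed.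

Lemma half_twisted_ramp (R : realType) (n : nat) (r : R) :
  half_twisted_state n r = ramp n (r / (n%:R - 2)).
Proof. by apply/rowP => i; rewrite !mxE mulrAC. Qed.

Lemma edge_ramp (R : realType) (n : nat) (b : R) (i : 'I_n.+1) :
  edge (ramp n.+1 b) i = b - (i == ord_max)%:R * (n.+1%:R * b).
Proof.
rewrite /edge !mxE /=; have [->|iN] := eqVneq i ord_max.
  by rewrite /= modnn mulr0 -natr1; ring.
have ltin : (i.+1 < n.+1)%N.
  by have := ltn_ord i; move: iN; rewrite -(inj_eq val_inj)/=; lia.
by rewrite modn_small// mul0r -[i.+1]addn1 natrD; ring.
Qed.

Lemma iter_ordSE (n j : nat) (i : 'I_n.+1) :
  iter j (@ordS n.+1) i = ((i + j) %% n.+1)%N :> nat.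
Proof.
elim: j => [|j IH] /=; first by rewrite addn0 modn_small.
by rewrite IH -addn1 modnDml addn1 addnS.
Qed.

Lemma edge_cyclic_perm (R : realType) (n j : nat) (u : 'rV[R]_n) (i : 'I_n) :
  edge (cyclic_perm j u) i = edge u (iter j (@ordS n) i).
Proof. by rewrite /edge !mxE -iterS iterSr. Qed.

Lemma potential_cyclic_perm (R : realType) (n j : nat) (K : R) (u : 'rV[R]_n) :
  potential K (cyclic_perm j u) = potential K u.
Proof.
congr (_ * _).
transitivity (\sum_i cos (2 * pi * edge u (iter j (@ordS n) i))).
  by apply: eq_bigr => i _; rewrite -edge_cyclic_perm.
rewrite [RHS](reindex_inj (_ : injective (iter j (@ordS n))))//.
elim: j => [|j IH] //= x y /(bij_inj (@ordS_bij n)); exact: IH.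
Qed.

Lemma potential_ramp (R : realType) (n : nat) (K b : R) :
  potential K (ramp n.+1 b) =
    - (K / (2 * pi)) * (n%:R * cos (2 * pi * b) + cos (2 * pi * (n%:R * b))).
Proof.
congr (_ * _); rewrite (bigD1 ord_max)//= addrC; congr (_ + _).
  transitivity (\sum_(i < n.+1 | i != ord_max) cos (2 * pi * b)).
    apply: eq_bigr => i /negPf iN.
    by have := edge_ramp b i; rewrite /edge => ->; rewrite iN mul0r subr0.
  by rewrite sumr_const cardC1 card_ord [RHS]mulr_natl.
have := edge_ramp b (@ord_max n); rewrite /edge => ->.
rewrite eqxx mul1r -[LHS]cosN; congr cos; rewrite -[n.+1]addn1 natrD; ring.
Qed.

(** With n + 1 indices, a is the slope of the saddle. Since (n + 1)/4 - 1/2 = (n - 1)/4, the bound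
    on Q is exactly a < 1/4. *)
Lemma slope_bounds (R : realType) (n : nat) (Q : int) (a : R) :
  1 <= Q -> Q%:~R < n.+1%:R / 4 :> R -> (n%:R - 1) * a = Q%:~R - 1 / 2 ->
  0 < a < 1 / 4.
Proof.
rewrite -(ler_int R) -natr1 => Q1 Qn aE; apply/andP; split; nra.
Qed.

(** The closing difference has size n a = Q - (1/2 - a), so its cosine is -cos(2 pi a) and cancels
    one of the n equal terms. *)
Lemma potential_saddle (R : realType) (n : nat) (K : R) (s Q : int) (a : R) :
  s * s = 1 -> (n%:R - 1) * a = Q%:~R - 1 / 2 ->
  potential K (ramp n.+1 (s%:~R * a)) =
    - (K / (2 * pi)) * ((n%:R - 1) * cos (2 * pi * a)).
Proof.
move=> s1 aE; rewrite potential_ramp [n%:R * (_ * _)]mulrCA !cos2pi_sign//; congr (_ * _).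
have -> : n%:R * a = - (1 / 2 - a) + Q%:~R by lra.
by rewrite cos2piDz mulrN cosN cos2pi_half; ring.
Qed.

Lemma potential_ramp_le (R : realType) (n : nat) (K : R) (s Q : int) (a b : R) :
  0 < K -> s * s = 1 -> (n%:R - 1) * a = Q%:~R - 1 / 2 -> 0 < a < 1 / 4 ->
  0 < n%:R - 1 :> R -> 0 <= b < 1 / 4 -> n.+1%:R * b <= Q%:~R ->
  potential K (ramp n.+1 (s%:~R * b)) <=
    - (K / (2 * pi)) * ((n%:R - 1) * cos (2 * pi * a)).
Proof.
move=> K0 s1 aE a4 n1 b4; rewrite -natr1 => bQ; have p0 := pi_gt0 R.
rewrite potential_ramp [n%:R * (_ * _)]mulrCA !cos2pi_sign// ler_nM2l; last first.
  by rewrite oppr_lt0 divr_gt0// mulr_gt0.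
(* b is the mean of n - 1 copies of a and one of w, so the tangents at b sum up
   to n cos(2 pi b). *)
pose w := n%:R * b - Q%:~R + 1 / 2.
have -> : n%:R * b = - (1 / 2 - w) + Q%:~R by rewrite /w; ring.
rewrite cos2piDz mulrN cosN cos2pi_half.
have ta : cos (2 * pi * a) <= _ := @cos2pi_le_tangent R b a b4 ltac:(lra).
(* The range condition w <= 1/2 - b is the hypothesis (n + 1) b <= Q. *)
have tw : cos (2 * pi * w) <= _ := @cos2pi_le_tangent R b w b4 ltac:(rewrite /w; lra).
have ta' := ler_wpM2l (ltW n1) ta.
have : (n%:R - 1) * (a - b) + (w - b) = 0 by rewrite mulrBr aE /w; ring.
move: ta' tw; set S := 2 * pi * sin _; set D := w - b; set E := a - b.
move=> ta' tw DE; have : S * ((n%:R - 1) * E + D) = 0 by rewrite DE mulr0.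
lra.
Qed.

Lemma phase_class_saddle (R : realType) (n : nat) (s Q : int) (a : R)
    (u : 'rV[R]_n.+1) (m : 'I_n.+1 -> int) (i0 : 'I_n.+1) :
  s * s = 1 -> (n%:R - 1) * a = Q%:~R - 1 / 2 ->
  s%:~R * edge u i0 + (m i0)%:~R = 1 / 2 - a ->
  (forall i, i != i0 -> s%:~R * edge u i + (m i)%:~R = a) ->
  phase_class (cyclic_perm (n - i0) (ramp n.+1 (s%:~R * a))) = phase_class u.
Proof.
move=> s1 aE e0 e; have sR : s%:~R * s%:~R = 1 :> R by rewrite -intrM s1.
(* The shift by n - [i0] moves the closing difference of the ramp from the last index to [i0]. There
   - n a and 1/2 - a differ by Q, whence the extra Q. *)
pose k i := if i == i0 then Q - m i else - m i.
apply: (@phase_class_edge _ _ _ _ (fun i => s * k i)) => i.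
rewrite edge_cyclic_perm edge_ramp -val_eqE/= iter_ordSE intrM.
have -> : ((i + (n - i0)) %% n.+1 == n)%N = (i == i0).
  have := ltn_ord i; have := ltn_ord i0; rewrite -val_eqE /= => l0 li.
  have [le|gt] := leqP i i0.
    by rewrite modn_small; lia.
  have -> : (i + (n - i0) = (i - i0).-1 + n.+1)%N by lia.
  by rewrite modnDr modn_small; lia.
rewrite /k; have [->|iN] := eqVneq i i0.
  have -> : edge u i0 = s%:~R * (s%:~R * edge u i0) by rewrite mulrA sR mul1r.
  have -> : s%:~R * edge u i0 = 1 / 2 - a - (m i0)%:~R by lra.
rewrite [true%:R * _]mul1r intrB.
  have na : n%:R * a = a + Q%:~R - 1 / 2 by lra.
  have -> : n.+1%:R * (s%:~R * a) = s%:~R * (n%:R * a + a).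
    by rewrite -[n.+1]addn1 natrD; ring.
  by rewrite na; field.
have -> : edge u i = s%:~R * (s%:~R * edge u i) by rewrite mulrA sR mul1r.
have -> : s%:~R * edge u i = a - (m i)%:~R by have := e i iN; lra.
by rewrite mul0r intrN; ring.
Qed.

(** * Energy bound outside the two regions *)

Lemma saddle_bound (R : realType) (n : nat) (K : R) (s Q : int) (a : R)
    (u : 'rV[R]_n.+1) :
  0 < K -> s * s = 1 -> (n%:R - 1) * a = Q%:~R - 1 / 2 -> 0 < a < 1 / 4 ->
  ~ region s (1 / 2 - a) [set Q] (phase_class u) ->
  ~ region (- s) (- (1 / 2 - a)) [set S : int | - Q - n.+1%:Z < S] (phase_class u) ->
  - (K / (2 * pi)) * ((n%:R - 1) * cos (2 * pi * a)) <= potential K u /\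
  (potential K u = - (K / (2 * pi)) * ((n%:R - 1) * cos (2 * pi * a)) ->
   exists2 j, (j <= n)%N &
     phase_class (cyclic_perm j (ramp n.+1 (s%:~R * a))) = phase_class u).
Proof.
move=> K0 s1 aE a4 nin nout; have p0 := pi_gt0 R.
have [m [mQ mc [i0 mi0]]] := between_regions nin nout.
rewrite (potential_edge K m u s1).
have Kn : - (K / (2 * pi)) < 0 by rewrite oppr_lt0 divr_gt0// mulr_gt0.
have n2 : n.+1%:R - 2 = n%:R - 1 :> R by rewrite -natr1; ring.
(* Differences around the cycle sum to zero, so the representatives sum to Q = (n - 1) a + 1/2. *)
have sy : \sum_i (s%:~R * edge u i + (m i)%:~R) = (n.+1%:R - 2) * a + 1 / 2.
  rewrite n2 aE big_split/= -mulr_sumr sum_edge mulr0 add0r -mQ.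
  by rewrite (raddf_sum (intmul (1 : R))) subrK.
have [le eq] := sum_cos_leif a4 mi0 mc sy; rewrite n2 in le eq.
split; first by rewrite ler_nM2l.
move/(mulfI (ltr0_neq0 Kn))/eqP; rewrite eq => /forallP sad.
exists (n - i0)%N; first exact: leq_subr.
apply: phase_class_saddle s1 aE mi0 _ => i iN.
by have /implyP/(_ iN)/eqP := sad i.
Qed.

(** * Twisted states in the regions; continuity of the connecting path *)

Lemma twisted_inner (R : realType) (n : nat) (s Q : int) (c : R) :
  s * s = 1 -> Q%:~R / n.+1%:R < c ->
  region s c [set Q] (phase_class (twisted_state R n.+1 (s * Q))).
Proof.
(* Adding Q to the closing difference makes all representatives equal to Q/(n + 1). *)
move=> s1 Qc; apply/region_phase_class; exists (fun i => if i == ord_max then Q else 0).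
  by rewrite /= -big_mkcond/= big_pred1_eq.
move=> i; have sR : s%:~R * s%:~R = 1 :> R by rewrite -intrM s1.
have n0 : n.+1%:R != 0 :> R by rewrite pnatr_eq0.
rewrite twisted_ramp edge_ramp [n.+1%:R * _]mulrC divfK// intrM mulrBr.
rewrite [X in X - _]mulrA mulrA sR mul1r.
case: ifP => _; last by rewrite mul0r mulr0 subr0 addr0.
by rewrite mul1r mulrA sR mul1r subrK.
Qed.

Lemma twisted_outer (R : realType) (n : nat) (s Q k : int) (c : R) :
  s * s = 1 -> s * k < Q -> c < (s * k)%:~R / n.+1%:R + 1 ->
  region (- s) (- c) [set S : int | - Q - n.+1%:Z < S]
    (phase_class (twisted_state R n.+1 k)).
Proof.
move=> s1 kQ kc; apply/region_phase_class.
(* The representatives are all s k/(n + 1), of sum s k < Q; the sign and the -1 come from the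
   encoding of the second region. *)
exists (fun i => (if i == ord_max then - (s * k) else 0) - 1).
  rewrite /= sumrB sumr_const card_ord natz -big_mkcond/= big_pred1_eq; lia.
move=> i; have n0 : n.+1%:R != 0 :> R by rewrite pnatr_eq0.
rewrite twisted_ramp edge_ramp [n.+1%:R * _]mulrC divfK// !intrB intrN.
move: kc; rewrite intrM -mulrA mulrBr mulNr.
set x := s%:~R * (k%:~R / n.+1%:R) => kc.
case: ifP => _; first by rewrite mul1r intrN intrM mulNr; lra.
by rewrite mul0r mulr0 mulr0z mulr1z; lra.
Qed.

Lemma within_ramp_continuous (R : realType) (n : nat) (s : int) (A : set R) (Q : R) :
  {within A, continuous (fun t : R => phase_class (ramp n (s%:~R * ((Q - t) / n%:R))))}.
Proof.
apply: continuous_subspaceT => t.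
have -> : (fun t : R => phase_class (ramp n (s%:~R * ((Q - t) / n%:R)))) =
   @phase_class R n \o (fun t => (Q - t) *: ramp n (s%:~R / n%:R)).
  by apply/funext => x /=; congr phase_class; apply/rowP => i; rewrite !mxE; ring.
apply: continuous_comp; last exact: pi_continuous.
exact: (cvgZ (cvgB (cvg_cst Q) cvg_id) (cvg_cst (ramp n (s%:~R / n%:R)))).
Qed.

(** * Communication height and relevant saddles *)

Unset Implicit Arguments.

Theorem proposition4p12 (R : realType) (n : nat) (hn : (5 <= n)%N)
    (K : R) (hK : 0 < K) (q : int) (hq1 : 1 <= `|q|)
    (hq : `|q|%:~R < n%:R / 4 :> R) :
  relevant_saddles K
    [set phase_class (twisted_state R n q)]
    [set phase_class (twisted_state R n k) |
       k in [set k : int | - `|q| + 1 <= k <= `|q| - 1]]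
    ([set phase_class
            (cyclic_perm j (half_twisted_state n (`|q|%:~R - 1 / 2 : R))) |
        j in [set j : nat | (0 <= j <= n - 1)%N]] `|`
     [set phase_class
            (cyclic_perm j (half_twisted_state n (- `|q|%:~R + 1 / 2 : R))) |
        j in [set j : nat | (0 <= j <= n - 1)%N]]).
Proof.
case: n hn hq => [//|n] n5 hq; rewrite subn1 /=.
pose Q : int := `|q|; rewrite -/Q in hq1 hq *.
pose a : R := (Q%:~R - 1 / 2) / (n%:R - 1).
have n1 : 0 < n%:R - 1 :> R by rewrite subr_gt0 ltr1n; lia.
have aE : (n%:R - 1) * a = Q%:~R - 1 / 2 by rewrite /a mulrC divfK// gt_eqF.
have a4 : 0 < a < 1 / 4 := slope_bounds hq1 hq aE.
have n2 : n.+1%:R - 2 = n%:R - 1 :> R by rewrite -natr1; ring.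
have halfE : half_twisted_state n.+1 (Q%:~R - 1 / 2) = ramp n.+1 (1%:~R * a).
  by rewrite half_twisted_ramp n2 [1%:~R * _]mul1r.
have halfNE : half_twisted_state n.+1 (- Q%:~R + 1 / 2) = ramp n.+1 ((-1)%:~R * a).
  rewrite half_twisted_ramp n2 intrN mulN1r /a -mulNr.
  by congr (ramp _ (_ / _)); ring.
rewrite {}halfE {}halfNE.
set A := [set phase_class (twisted_state R n.+1 q)].
set B := [set phase_class _ | k in _].
set W := _ `|` _.
pose h : R := - (K / (2 * pi)) * ((n%:R - 1) * cos (2 * pi * a)).
have [s s1 qE] : exists2 s : int, s * s = 1 & q = s * Q.
  exists (if 0 <= q then 1 else -1); first by case: ifP.
  by rewrite /Q; case: ifP => q0; [rewrite ger0_norm ?mul1r|rewrite ltr0_norm; lia].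
have sP : s = 1 \/ s = -1.
  by move/eqP: s1; rewrite -expr2 sqrf_eq1 => /orP[]/eqP; [left|right].
have WE j : (j <= n)%N -> W (phase_class (cyclic_perm j (ramp n.+1 (s%:~R * a)))).
  by move=> jn; case: sP => ->; [left|right]; exists j.
have Wh w : W w -> phase_potential K w = h.
  by case=> -[j _ <-]; rewrite phase_potentialE potential_cyclic_perm;
     exact: potential_saddle aE.
(* This point serves twice: it bounds the height of every path from below, and on a minimal path it
   lies in W. *)
have cross g : paths A B g -> exists2 t : R, 0 <= t <= 1 &
    h <= phase_potential K (g t) /\ (phase_potential K (g t) = h -> W (g t)).
  move=> [cg g0 [k /= kQ g1]].
  have qn : Q%:~R / n.+1%:R < 1 / 4 :> R by rewrite ltr_pdivrMr ?ltr0n//; lra.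
  have V0 : region s (1 / 2 - a) [set Q] (g 0).
    by rewrite g0 qE; apply: twisted_inner => //; apply: lt_trans qn _; lra.
  have N1 : region (- s) (- (1 / 2 - a)) [set S : int | - Q - n.+1%:Z < S] (g 1).
    rewrite -g1; have [skl sku] : - Q + 1 <= s * k /\ s * k < Q.
      by case: sP => ->; lia.
    apply: twisted_outer => //; rewrite -ltrBlDr.
    (* The target slope exceeds - Q/(n + 1) > -1/4, while c - 1 = -1/2 - a lies below -1/4. *)
    apply: (@lt_trans _ _ (- (1 / 4))); first by lra.
    rewrite ltr_pdivlMr ?ltr0n//; move: skl; rewrite -(ler_int R) intrD intrN; lra.
  have [t t01 [nin nout]] := connected_crossing (@open_region _ _ _ _ _)
    (@open_region _ _ _ _ _) (region_disjoint _ _ _ _) cg V0 N1.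
  exists t => //; have [u gtE] : exists u, g t = phase_class u.
    by exists (repr (g t)); exact/esym/reprK.
  rewrite gtE in nin nout *.
  have [le eq] := saddle_bound hK s1 aE a4 nin nout.
  rewrite phase_potentialE; split => // /eq[j jn <-]; exact: WE.
have cross_le g : paths A B g -> (h%:E <= path_height K g)%E.
  move=> /cross[t t01 [le _]]; apply: le_trans (ereal_sup_ubound _); last first.
    by exists t => //=; rewrite in_itv.
  by rewrite lee_fin.
have hE : communication_height K A B = h%:E.
  apply/eqP; rewrite eq_le; apply/andP; split; last first.
    by apply: le_ereal_inf_tmp => _ [g gAB <-]; exact: cross_le.
  pose g (t : R) : phase_space R n.+1 :=
    phase_class (ramp n.+1 (s%:~R * ((Q%:~R - t) / n.+1%:R))).
  have gAB : paths A B g.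
    split.
    - exact: within_ramp_continuous.
    - by rewrite /g subr0 /A /= qE twisted_ramp intrM mulrA.
    (* The connecting path ends at the target adjacent to q. *)
    - exists (s * (Q - 1)); first by case: sP => -> /=; lia.
      by rewrite /g twisted_ramp intrM intrB mulrA.
  apply: (@le_trans _ _ (path_height K g)).
    by apply: ereal_inf_lbound; exists g.
  apply: ge_ereal_sup => _ [t /= t01 <-]; rewrite lee_fin phase_potentialE.
  have [/andP[t0 t1] Q1] : 0 <= t <= 1 /\ 1 <= Q%:~R :> R.
    by move: t01; rewrite in_itv/= ler1z.
  apply: (potential_ramp_le hK s1 aE a4 n1); last first.
    by rewrite mulrC divfK ?pnatr_eq0//; lra.
  rewrite divr_ge0 ?ler0n ?subr_ge0 ?(le_trans t1)//= ltr_pdivrMr ?ltr0n//; lra.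
have fin : finite_set [set j : nat | (j <= n)%N] by exact: finite_II n.+1.
split.
- by rewrite finite_setU; split; exact: finite_image.
- by move=> w /Wh ->; rewrite hE.
- move=> g [gAB]; rewrite hE => gh; have [t t01 [le eq]] := cross g gAB.
  (* The supremum along g is h, so the energy at the crossing point, already at least h, equals
     h. *)
  exists t => //; apply: eq; apply/le_anti; rewrite le andbT -lee_fin -gh.
  by apply: ereal_sup_ubound; exists t => //=; rewrite in_itv.
Qed.
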